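(* As $n \to \infty$, $$ex\bigl(n, n^{2/3}, \{C_4, \theta_{3,4}\}\bigr) = \Theta\bigl(n^{1+\frac{1}{9}}\bigr).$$ That is, there exist constants $c_1, c_2 > 0$ and $n_0$ such that for all integers $n \geq n_0$, $$c_1 n^{1+\frac{1}{9}} \leq ex\bigl(n, \lfloor n^{2/3} \rfloor, \{C_4, \theta_{3,4}\}\bigr) \leq c_2 n^{1+\frac{1}{9}}.$$
   Context: For a family $\mathcal{F}$ of graphs, $ex(a,b,\mathcal{F})$ is the maximum number of edges in a bipartite graph whose part sizes are $a$ and $b$ and which contains no graph in $\mathcal{F}$ as a (not necessarily induced) subgraph. $C_4$ is the cycle of length 4. $\theta_{3,4}$ is the theta graph consisting of two vertices joined by $4$ internally vertex-disjoint paths, each with exactly 3 edges. When a part size is given by a non-integer real number, it is rounded down to an integer. *)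

(* Defs.v *)
From mathcomp Require Import all_boot all_order all_algebra.
From mathcomp Require Import all_classical all_reals all_analysis.
Set Implicit Arguments.
Unset Strict Implicit.
Unset Printing Implicit Defensive.

Record sgraph := SGraph {
  vertex :> finType;
  adj : rel vertex;
  adj_sym : symmetric adj;
  adj_irr : irreflexive adj }.

(* The simple graph whose edges are the {x, y} with x != y and r x y. *)
Definition sym_rel (T : eqType) (r : rel T) : rel T :=
  fun x y => (x != y) && (r x y || r y x).

Lemma sym_rel_sym (T : eqType) (r : rel T) : symmetric (sym_rel r).
Proof. by move=> x y; rewrite /sym_rel eq_sym orbC. Qed.

Lemma sym_rel_irr (T : eqType) (r : rel T) : irreflexive (sym_rel r).
Proof. by move=> x; rewrite /sym_rel eqxx. Qed.

Definition graph_of_rel (T : finType) (r : rel T) : sgraph :=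
  SGraph (@sym_rel_sym T r) (@sym_rel_irr T r).

(* H is isomorphic to a (not necessarily induced) subgraph of G. *)
Definition contains (G H : sgraph) : bool :=
  [exists f : {ffun H -> G},
    injectiveb f && [forall x, forall y, adj x y ==> adj (f x) (f y)]].

(* A cycle in the usual sense only for n >= 3. *)
Definition cycle_graph (n : nat) : sgraph :=
  graph_of_rel (fun i j : 'I_n => j == ordS i).

(* In theta_graph k l, the end vertices are inl false and inl true;
   inr (i, s) is the internal vertex of the i-th path at distance s.+1 from
   inl false, so theta_vertex i t below is the vertex of that path at
   distance t from inl false, for t <= k. *)
Definition theta_vertex (k l : nat) (i : 'I_l) (t : nat) :
    bool + 'I_l * 'I_k.-1 :=
  if t is s.+1 then
    if insub s is Some j then inr (i, j) else inl true
  else inl false.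

(* The graph theta_{k,l}: l internally disjoint paths, with k edges each. *)
Definition theta_graph (k l : nat) : sgraph :=
  graph_of_rel (fun x y : bool + 'I_l * 'I_k.-1 =>
    [exists i : 'I_l, exists t : 'I_k,
      (x == theta_vertex k i t) && (y == theta_vertex k i t.+1)]).

(* A bipartite graph with part sizes a and b is given by its edge set,
   a subset of 'I_a * 'I_b. *)
Definition bipartite_graph (a b : nat) (E : {set 'I_a * 'I_b}) : sgraph :=
  graph_of_rel (fun x y : 'I_a + 'I_b =>
    match x, y with
    | inl u, inr v => (u, v) \in E
    | _, _ => false
    end).

(* The maximum is over a nonempty set as soon as every graph in F has an edge
   (and is 0 over the empty set). *)
Definition ex_bip (a b : nat) (F : seq sgraph) : nat :=
  \max_(E : {set 'I_a * 'I_b} |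
        all (fun H => ~~ contains (bipartite_graph E) H) F) #|E|.

(* Main.v *)
Require Import Defs.
From mathcomp Require Import all_boot all_order all_algebra.
From mathcomp Require Import all_classical all_reals all_analysis.
From mathcomp Require Import all_field.
From mathcomp Require Import zify ring lra.
Import Order.TTheory GRing.Theory Num.Theory.
Set Implicit Arguments.
Unset Strict Implicit.
Unset Printing Implicit Defensive.

(* Upper bound.  In a C_4-free graph the paths with 3 edges between two given
   vertices are internally disjoint, so that without theta_{3,4} there are at
   most 3 n m of them in all, where m is the size of the second part.  A graph
   with e edges has at least of the order of e (e/n) (e/m) such paths, because
   half of its edges have both ends of at least a quarter of the average
   degree; hence e = O((n m)^(2/3)).

   Lower bound.  Let K = F_q and let L be its extension of degree 4.  Join the
   q^6 points of the affine space K * K * L to those q^9 of its lines that have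
   a direction (1, N(s), s) with s in L, where N is the norm.  Two lines share
   at most one point.  The 3-paths between a line u and a point v lie in the
   plane that they span, so that the directions of their lines are collinear.
   But N has degree 4 and no nontrivial zero, so that a line of K * L contains
   at most 4 of the points (N(s), s); one of these is the direction of u
   itself, and this leaves at most 3 paths. *)

(** * Forbidden subgraphs as conditions on a bipartite relation *)

Definition c4_free (A B : Type) (E : A -> B -> bool) : Prop :=
  forall u u' v v', E u v -> E u' v -> E u v' -> E u' v' -> u = u' \/ v = v'.

(** The [i]-th path is [u], [x i], [y i], [v]. The [x i] and the [y i] lie in opposite parts, so
    these four conditions already make all vertices distinct. *)
Definition theta3_copy (A B : Type) (E : A -> B -> bool) (l : nat)
    (u : A) (v : B) (x : 'I_l -> B) (y : 'I_l -> A) : Prop :=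
  [/\ injective x, injective y, forall i, x i <> v, forall i, y i <> u &
      forall i, [/\ E u (x i), E (y i) (x i) & E (y i) v]].

Definition theta3_free (A B : Type) (E : A -> B -> bool) (l : nat) : Prop :=
  forall u v (x : 'I_l -> B) (y : 'I_l -> A), ~ theta3_copy E u v x y.

Definition edge_rel (a b : nat) (E : {set 'I_a * 'I_b}) (u : 'I_a) (v : 'I_b) :=
  (u, v) \in E.

Lemma containsP (G H : sgraph) :
  reflect (exists f : H -> G,
             injective f /\ forall x y, adj x y -> adj (f x) (f y))
          (contains G H).
Proof.
apply: (iffP existsP) =>
  [[f /andP[/injectiveP inj_f /forallP hf]] | [f [inj_f hf]]].
  by exists f; split=> // x y; move/forallP: (hf x) => /(_ y) /implyP.
exists (finfun f); apply/andP; split.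
  by apply/injectiveP => x y; rewrite !ffunE => /inj_f.
by apply/forallP => x; apply/forallP => y; apply/implyP => /hf; rewrite !ffunE.
Qed.

Section BipartiteSubgraphs.
Variables (a b : nat) (E : {set 'I_a * 'I_b}).
Let G := bipartite_graph E.

Lemma adj_bip (x y : G) :
  adj x y = match x, y with
            | inl u, inr v | inr v, inl u => (u, v) \in E
            | _, _ => false
            end.
Proof. by case: x y => [u|v] [u'|v']; rewrite /= /sym_rel /= ?andbF ?orbF. Qed.

Lemma adj_cycle4 (i j : cycle_graph 4) :
  adj i j = (nat_of_ord i != j) &&
    ((nat_of_ord j == i.+1 %% 4) || (nat_of_ord i == j.+1 %% 4)).
Proof. by []. Qed.

Lemma contains_cycle4 : ~~ contains G (cycle_graph 4) <-> c4_free (edge_rel E).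
Proof.
split=> [/containsP noC4 u u' v v' uv u'v uv' u'v' | c4f].
  have [->|nu] := eqVneq u u'; first by left.
  have [->|nv] := eqVneq v v'; first by right.
  case: noC4.
  exists (fun i : 'I_4 =>
    tnth [tuple (inl u : G); inr v; inl u'; inr v'] i); split.
    move=> [[|[|[|[]]]] //= lti] [[|[|[|[]]]] //= ltj];
      rewrite !(tnth_nth (inl u)) //=;
      by [move=> _; apply: val_inj
         |move=> [] /eqP; rewrite ?(negPf nu) ?(negPf nv) //
            eq_sym ?(negPf nu) ?(negPf nv)].
  move=> i j; rewrite adj_cycle4 adj_bip !(tnth_nth (inl u)).
  by case: i j => [[|[|[|[|//]]]] lti] [[|[|[|[|//]]]] ltj].
apply/containsP => -[f [inj_f hf]].
pose c (i : 'I_4) : cycle_graph 4 := i.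
pose i0 := c (inord 0); pose i1 := c (inord 1).
pose i2 := c (inord 2); pose i3 := c (inord 3).
have n02 : f i0 <> f i2.
  by move/inj_f => /(congr1 (@nat_of_ord 4)); rewrite !inordK.
have n13 : f i1 <> f i3.
  by move/inj_f => /(congr1 (@nat_of_ord 4)); rewrite !inordK.
have e01 : adj (f i0) (f i1) by apply: hf; rewrite adj_cycle4 !inordK.
have e12 : adj (f i1) (f i2) by apply: hf; rewrite adj_cycle4 !inordK.
have e23 : adj (f i2) (f i3) by apply: hf; rewrite adj_cycle4 !inordK.
have e30 : adj (f i3) (f i0) by apply: hf; rewrite adj_cycle4 !inordK.
move: n02 n13 e01 e12 e23 e30; rewrite !adj_bip.
(* A 4-cycle alternates between the parts; the two surviving cases differ in the part that contains
   vertex 0. *)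
case: (f i0) (f i1) (f i2) (f i3) =>
  [u|v] [u'|v'] [u2|v2] [u3|v3] //= n02 n13 e1 e2 e3 e4.
  by case: (c4f _ _ _ _ e1 e2 e4 e3) => ?;
    [apply: n02 | apply: n13]; congr (_ _).
by case: (c4f _ _ _ _ e1 e4 e2 e3) => ?;
  [apply: n13 | apply: n02]; congr (_ _).
Qed.

Lemma theta3_vertexE (l : nat) (i : 'I_l) :
  [/\ theta_vertex 3 i 0 = inl false, theta_vertex 3 i 1 = inr (i, ord0),
      theta_vertex 3 i 2 = inr (i, ord_max) & theta_vertex 3 i 3 = inl true].
Proof.
split=> //; rewrite /theta_vertex.
- by case: insubP => // j _ j0; congr (inr (_, _)); apply: val_inj.
- by case: insubP => // j _ j1; congr (inr (_, _)); apply: val_inj.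
- by rewrite insubF.
Qed.

Lemma adj_theta_vertex (k l : nat) (i : 'I_l) (t : nat) : t < k ->
  theta_vertex k i t != theta_vertex k i t.+1 ->
  @adj (theta_graph k l) (theta_vertex k i t) (theta_vertex k i t.+1).
Proof.
move=> tk ne; apply/andP; split=> //; apply/orP; left.
by apply/existsP; exists i; apply/existsP; exists (Ordinal tk); rewrite !eqxx.
Qed.

Lemma adj_theta3 (l : nat) (i : 'I_l) :
  let T := theta_graph 3 l in
  [/\ adj (inl false : T) (inr (i, ord0)),
      adj (inr (i, ord0) : T) (inr (i, ord_max)) &
      adj (inr (i, ord_max) : T) (inl true)].
Proof.
have [e0 e1 e2 e3] := theta3_vertexE i.
split; rewrite -?e0 -?e1 -?e2 -?e3; apply: adj_theta_vertex => //;
  by rewrite ?e0 ?e1 ?e2 ?e3 //; apply/eqP => -[].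
Qed.

(** The paths have odd length, so any one of them forces the ends into opposite parts; [0 < l]
    provides such a path. *)
Lemma contains_theta3 (l : nat) : 0 < l ->
  ~~ contains G (theta_graph 3 l) <-> theta3_free (edge_rel E) l.
Proof.
move=> l0; split=> [/containsP noT u v x y [inj_x inj_y xv yu uxyv] | thf].
  case: noT.
  exists (fun w : theta_graph 3 l => match w with
    | inl false => inl u : G
    | inl true => inr v
    | inr (i, j) => if j == ord0 then inr (x i) else inl (y i)
    end); split.
    case=> [[]|[i j]] [[]|[i' j']] //; do ?case: eqP => //.
    + by move=> _ [] /esym/xv.
    + by move=> _ [] /esym/yu.
    + by move=> _ [] /xv.
    + by move=> _ [] /yu.
    + by move=> -> -> [] /inj_x ->.
    have o2 (k : 'I_3.-1) : k <> ord0 -> k = ord_max.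
      case: k => [[|[|//]] lt] nk; apply: val_inj => //.
      by case: nk; apply: val_inj.
    by move=> /o2 -> /o2 -> [] /inj_y ->.
  move=> w w' /andP[_].
  wlog: w w' / [exists i : 'I_l, exists t : 'I_3,
      (w == theta_vertex 3 i t) && (w' == theta_vertex 3 i t.+1)].
    move=> H /orP[h|h]; first by apply: H => //; rewrite h.
    by rewrite adj_sym; apply: H => //; rewrite h.
  move=> /existsP[i /existsP[t /andP[/eqP -> /eqP ->]]] _.
  have [e0 e1 e2 e3] := theta3_vertexE i; have [h1 h2 h3] := uxyv i.
  by case: t => [[|[|[|//]]] lt]; rewrite adj_bip ?e0 ?e1 ?e2 ?e3 //=.
apply/containsP => -[f [inj_f hf]].
pose z0 : theta_graph 3 l := inl false; pose z1 : theta_graph 3 l := inl true.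
pose s (i : 'I_l) : theta_graph 3 l := inr (i, ord0).
pose t (i : 'I_l) : theta_graph 3 l := inr (i, ord_max).
have inj_s : injective s by move=> i j [].
have inj_t : injective t by move=> i j [].
have {}hf i :
  [/\ adj (f z0) (f (s i)), adj (f (s i)) (f (t i)) & adj (f (t i)) (f z1)].
  by have [h1 h2 h3] := adj_theta3 i; split; apply: hf.
have sz1 i : f (s i) <> f z1 by move/inj_f.
have tz0 i : f (t i) <> f z0 by move/inj_f.
have {}inj_s i j : f (s i) = f (s j) -> i = j by move/inj_f/inj_s.
have {}inj_t i j : f (t i) = f (t j) -> i = j by move/inj_f/inj_t.
case fz0: (f z0) => [u|v].
  have [x xE] : exists x : 'I_l -> 'I_b, forall i, f (s i) = inr (x i).
    apply: (@fin_all_exists _ (fun=> 'I_b) (fun i w => f (s i) = inr w)) => i.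
    have [] := hf i; rewrite fz0 adj_bip.
    by case: (f (s i)) => // x; exists x.
  have [y yE] : exists y : 'I_l -> 'I_a, forall i, f (t i) = inl (y i).
    apply: (@fin_all_exists _ (fun=> 'I_a) (fun i w => f (t i) = inl w)) => i.
    have [_] := hf i; rewrite xE adj_bip.
    by case: (f (t i)) => // y; exists y.
  case fz1: (f z1) => [v|v].
    by have [_ _] := hf (Ordinal l0); rewrite yE fz1 adj_bip.
  case: (thf u v x y); split.
  - by move=> i j xij; apply: inj_s; rewrite !xE xij.
  - by move=> i j yij; apply: inj_t; rewrite !yE yij.
  - by move=> i xi; apply: (sz1 i); rewrite xE fz1 xi.
  - by move=> i yi; apply: (tz0 i); rewrite yE fz0 yi.
  - by move=> i; have := hf i; rewrite xE yE fz0 fz1 !adj_bip.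
(* Now [inl false] lands in the second part: reading every path from its other end exchanges the
   roles of [x] and [y]. *)
have [y yE] : exists y : 'I_l -> 'I_a, forall i, f (s i) = inl (y i).
  apply: (@fin_all_exists _ (fun=> 'I_a) (fun i w => f (s i) = inl w)) => i.
  have [] := hf i; rewrite fz0 adj_bip.
  by case: (f (s i)) => // y; exists y.
have [x xE] : exists x : 'I_l -> 'I_b, forall i, f (t i) = inr (x i).
  apply: (@fin_all_exists _ (fun=> 'I_b) (fun i w => f (t i) = inr w)) => i.
  have [_] := hf i; rewrite yE adj_bip.
  by case: (f (t i)) => // x; exists x.
case fz1: (f z1) => [u|u]; last first.
  by have [_ _] := hf (Ordinal l0); rewrite xE fz1 adj_bip.
case: (thf u v x y); split.
- by move=> i j xij; apply: inj_t; rewrite !xE xij.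
- by move=> i j yij; apply: inj_s; rewrite !yE yij.
- by move=> i xi; apply: (tz0 i); rewrite xE fz0 xi.
- by move=> i yi; apply: (sz1 i); rewrite yE fz1 yi.
- by move=> i; have [] := hf i; rewrite xE yE fz0 fz1 !adj_bip.
Qed.
End BipartiteSubgraphs.

(** * Counting paths with three edges *)

Section PathCounting.
Variables (A B : finType) (E : A -> B -> bool).
Let degl (y : A) := #|[set v | E y v]|.
Let degr (x : B) := #|[set u | E u x]|.
Let edges := #|[set p : A * B | E p.1 p.2]|.

(* [p] is the middle edge and [q] the pair of ends of a path with 3 edges. *)
Let path3 (p q : A * B) :=
  [&& E p.1 p.2, E q.1 p.2, E p.1 q.2, p.1 != q.1 & p.2 != q.2].

(* Two 3-paths with the same ends that share an inner vertex also share the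
   other one, for otherwise there is a 4-cycle; hence they are internally
   disjoint. *)
Lemma card_path3_le (l : nat) (q : A * B) :
  c4_free E -> theta3_free E l.+1 -> #|[set p | path3 p q]| <= l.
Proof.
move=> c4f thf; rewrite leqNgt; apply/negP => lt_l.
pose f (i : 'I_l.+1) := enum_val (widen_ord lt_l i).
have fP i : path3 (f i) q by have := enum_valP (widen_ord lt_l i); rewrite inE.
have inj_f : injective f.
  by move=> i j /enum_val_inj/(congr1 val)/= ij; apply: val_inj.
case: (thf q.1 q.2 (fun i => (f i).2) (fun i => (f i).1)); split.
- move=> i j /= eq2; apply: inj_f.
  have [/and5P[e1 e2 e3 _ n1] /and5P[e4 e5 e6 _ n2]] := (fP i, fP j).
  rewrite -eq2 in e4 e5.
  have [eq1|eq1] := c4f _ _ _ _ e1 e4 e3 e6; last by rewrite eq1 eqxx in n1.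
  by rewrite [f i]surjective_pairing [f j]surjective_pairing eq1 eq2.
- move=> i j /= eq1; apply: inj_f.
  have [/and5P[e1 e2 e3 n1 _] /and5P[e4 e5 e6 n2 _]] := (fP i, fP j).
  rewrite -eq1 in e4 e6.
  have [eq2|eq2] := c4f _ _ _ _ e1 e2 e4 e5; first by rewrite eq2 eqxx in n1.
  by rewrite [f i]surjective_pairing [f j]surjective_pairing eq1 eq2.
- by move=> i; apply/eqP; case/and5P: (fP i).
- by move=> i; apply/eqP; case/and5P: (fP i).
- by move=> i; case/and5P: (fP i).
Qed.

(** Double counting of 3-paths. A middle edge [(y, x)] extends by a neighbour of [x] other than [y]
    and a neighbour of [y] other than [x], while each pair of ends carries at most [l] paths. *)
Lemma sum_path3_le (l : nat) : c4_free E -> theta3_free E l.+1 ->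
  \sum_(p : A * B | E p.1 p.2) (degl p.1).-1 * (degr p.2).-1 <=
  l * (#|A| * #|B|).
Proof.
move=> c4f thf.
have -> : \sum_(p : A * B | E p.1 p.2) (degl p.1).-1 * (degr p.2).-1 =
    \sum_(p : A * B) \sum_(q | path3 p q) 1.
  rewrite big_mkcond; apply: eq_bigr => -[y x] _ /=.
  case: ifP => [yx|yx]; last first.
    by rewrite big1 // => q; rewrite /path3 /= yx.
  rewrite sum1_card mulnC.
  have <- : #|[set u | E u x] :\ y| = (degr x).-1.
    by rewrite /degr (cardsD1 y [set u | E u x]) inE yx.
  have <- : #|[set v | E y v] :\ x| = (degl y).-1.
    by rewrite /degl (cardsD1 x [set v | E y v]) inE yx.
  rewrite -cardsX; apply: eq_card => -[u v].
  rewrite !inE /= unfold_in /path3 /= yx /=.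
  rewrite (eq_sym y u) (eq_sym x v).
  by case: (E u x); case: (E y v); case: (u == y); case: (v == x).
rewrite (exchange_big_dep predT) //=.
apply: leq_trans (_ : \sum_(q : A * B) l <= _).
  apply: leq_sum => q _; rewrite sum1_card.
  apply: leq_trans (card_path3_le q c4f thf).
  by apply: subset_leq_card; apply/fintype.subsetP => p; rewrite inE.
by rewrite sum_nat_const card_prod mulnC.
Qed.

Lemma card_edges_degl (P : pred A) :
  #|[set p : A * B | E p.1 p.2 && P p.1]| = \sum_(y | P y) degl y.
Proof.
rewrite -sum1_card.
have deglE y : degl y = \sum_(v | E y v) 1.
  by rewrite /degl -sum1_card; apply: eq_bigl => v; rewrite inE.
under [RHS]eq_bigr => y _ do rewrite deglE.
by rewrite pair_big_dep; apply: eq_bigl => p; rewrite inE andbC.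
Qed.

(** The vertices with less than a quarter of the average degree number at most [#|A|], and each
    meets fewer than [edges / (4 * #|A|)] edges. *)
Lemma card_low_degl :
  4 * #|[set p : A * B | E p.1 p.2 && (4 * #|A| * degl p.1 < edges)]| <= edges.
Proof.
have [a0|a_gt0] := posnP #|A|.
  by rewrite eq_card0 // => p; have := fintype0 p.1 a0.
rewrite (card_edges_degl (fun y => 4 * #|A| * degl y < edges)).
rewrite -(leq_pmul2l a_gt0) mulnCA mulnA big_distrr /=.
apply: leq_trans (_ : \sum_(y | 4 * #|A| * degl y < edges) edges <= _).
  by apply: leq_sum => y /ltnW.
by rewrite sum_nat_const leq_mul2r max_card orbT.
Qed.
End PathCounting.

(** * The upper bound on the number of edges *)

Section EdgeBound.
Variables (A B : finType) (E : A -> B -> bool) (l : nat).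
Hypotheses (c4f : c4_free E) (thf : theta3_free E l.+1).
Let degl (y : A) := #|[set v | E y v]|.
Let degr (x : B) := #|[set u | E u x]|.
Let edges := #|[set p : A * B | E p.1 p.2]|.

Lemma card_low_degr :
  4 * #|[set p : A * B | E p.1 p.2 && (4 * #|B| * degr p.2 < edges)]| <= edges.
Proof.
have swapE (Q : pred (A * B)) :
    #|[set p | Q p]| = #|[set p : B * A | Q (p.2, p.1)]|.
  have swap_inj : injective (fun p : A * B => (p.2, p.1)).
    by move=> [x y] [x' y'] [-> ->].
  rewrite -(card_imset _ swap_inj); apply: eq_card => -[x y].
  apply/imsetP/idP => [[[y' x'] Qp [-> ->]]|]; first by rewrite !inE in Qp *.
  by rewrite inE => Qp; exists (y, x); rewrite ?inE.
by rewrite /edges !swapE; apply: (card_low_degl (fun x y => E y x)).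
Qed.

Lemma c4_theta3_free_edges :
  [\/ edges <= 8 * #|A|, edges <= 8 * #|B| |
      edges ^ 3 <= 128 * l * (#|A| * #|B|) ^ 2].
Proof.
have [|a8] := leqP edges (8 * #|A|); first by constructor 1.
have [|b8] := leqP edges (8 * #|B|); first by constructor 2.
constructor 3.
pose lowl := [set p : A * B | E p.1 p.2 && (4 * #|A| * degl p.1 < edges)].
pose lowr := [set p : A * B | E p.1 p.2 && (4 * #|B| * degr p.2 < edges)].
(* Each of the two low sets holds at most a quarter of the edges, so at least half of them are
   left. *)
pose high := [set p : A * B | E p.1 p.2] :\: (lowl :|: lowr).
have le_high : edges <= 2 * #|high|.
  have le_lowl : 4 * #|lowl| <= edges := card_low_degl E.
  have le_lowr : 4 * #|lowr| <= edges := card_low_degr.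
  have [le_low _] := leq_card_setU lowl lowr.
  have := cardsID (lowl :|: lowr) [set p : A * B | E p.1 p.2].
  have := subset_leq_card (subsetIr [set p : A * B | E p.1 p.2] (lowl :|: lowr)).
  rewrite -/edges -/high; lia.
have highP p : p \in high ->
    edges ^ 2 <= 64 * (#|A| * #|B|) * ((degl p.1).-1 * (degr p.2).-1).
  rewrite !inE => /andP[/norP[]] + + Ep; rewrite Ep /= -!leqNgt => ha hb.
  (* Outside the two sparse cases these degrees exceed 2, so that passing from [d] to [d.-1] costs
     at most a factor 2 on each side: 64 = (2 * 4)^2. *)
  have aux e a d : 8 * a < e -> e <= 4 * a * d -> e <= 8 * a * d.-1.
    by case: d => [|[|d]]; lia.
  have := leq_mul (aux _ _ _ a8 ha) (aux _ _ _ b8 hb).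
  by rewrite mulnn mulnACA (mulnACA 8 #|A| 8).
have le_sum : #|high| * edges ^ 2 <= 64 * (#|A| * #|B|) * (l * (#|A| * #|B|)).
  rewrite -sum_nat_const.
  apply: (@leq_trans (\sum_(p in high)
    64 * (#|A| * #|B|) * ((degl p.1).-1 * (degr p.2).-1))).
    by apply: leq_sum => p /highP.
  rewrite -big_distrr leq_mul2l /=; apply/orP; right.
  apply: leq_trans (sum_path3_le c4f thf).
  rewrite big_mkcond [leqRHS]big_mkcond /=; apply: leq_sum => p _.
  by rewrite !inE; case: ifP => // /andP[_ ->].
rewrite -mulnn expnS; nia.
Qed.
End EdgeBound.

Local Open Scope ring_scope.

(** * The norm over a finite field and the point-line construction *)

Section NormConstruction.
Variables (L : finFieldType) (q d : nat).
Hypotheses (q_gt1 : (1 < q)%N) (pchar_q : [pchar L].-nat q)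
  (cardL : #|L| = (q ^ d)%N) (d_gt1 : (1 < d)%N).

(** The ring [R] is kept general because both [L] and [{poly L}] occur. *)
Lemma frobD (R : comNzRingType) (i : nat) (x y : R) : [pchar R] =i [pchar L] ->
  (x + y) ^+ (q ^ i) = x ^+ (q ^ i) + y ^+ (q ^ i).
Proof.
move=> e; apply: exprDn_pchar; rewrite (eq_pnat _ e).
by rewrite pnatX pchar_q.
Qed.

Lemma frobB (R : comNzRingType) (i : nat) (x y : R) : [pchar R] =i [pchar L] ->
  (x - y) ^+ (q ^ i) = x ^+ (q ^ i) - y ^+ (q ^ i).
Proof.
by move=> e; apply: (addIr (y ^+ (q ^ i))); rewrite -frobD // !subrK.
Qed.

(** As Frobenius is additive, the powers [('X^q - 'X) ^+ (q ^ i)] telescope to ['X^(q ^ d) - 'X]. *)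
Lemma dvdp_XqX : ('X^q - 'X : {poly L}) %| 'X^#|L| - 'X.
Proof.
have -> : 'X^#|L| - 'X = \sum_(0 <= i < d) ('X^q - 'X) ^+ (q ^ i) :> {poly L}.
  have powE i : ('X^q - 'X) ^+ (q ^ i) = 'X^(q ^ i.+1) - 'X^(q ^ i) :> {poly L}.
    by rewrite frobB -?exprM -?expnS //; apply: pchar_poly.
  under eq_bigr => i _ do rewrite powE.
  by rewrite telescope_sumr // cardL expn0 expr1.
elim/big_ind: _ => [|u v|i _]; first exact: dvdp0.
  exact: dvdp_add.
by apply: dvdp_exp => //; rewrite expn_gt0 ltnW.
Qed.

(** By the divisibility above, ['X^q - 'X] is, up to a unit, a product of distinct linear factors;
    its degree then counts its roots, the fixed points of Frobenius. *)
Lemma card_fixed_frob : #|{: {x : L | x ^+ q == x}}| = q.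
Proof.
rewrite card_sig.
have := dvdp_XqX; rewrite finField_genPoly => /dvdp_prod_XsubC[m eq_m].
set s := mask m _ in eq_m.
have us : uniq s by rewrite mask_uniq // index_enum_uniq.
have : size ('X^q - 'X : {poly L}) = q.+1.
  by rewrite size_polyDl size_polyXn // size_polyN size_polyX.
rewrite (eqp_size eq_m) size_prod_XsubC => -[size_s].
rewrite -[RHS]size_s -(card_uniqP us); apply: eq_card => x.
rewrite inE -(root_prod_XsubC s x) -(eqp_root eq_m) rootE !hornerE.
by rewrite subr_eq0.
Qed.

(** The norm from [L] to its subfield of order [q], as the product of the Galois conjugates. *)
Definition frob_norm (s : L) : L := \prod_(j < d) s ^+ (q ^ j).

Lemma frob_norm_fixed (s : L) : frob_norm s ^+ q == frob_norm s.
Proof.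
rewrite /frob_norm -(big_mkord predT (fun j => s ^+ (q ^ j))).
case: d d_gt1 cardL => // d' _ cL.
(* Raising to the power [q] shifts the conjugates cyclically, the last one returning to [s] since
   [s ^+ #|L| = s]. *)
rewrite -prodrXl big_nat_recr //= big_nat_recl //= mulrC.
apply/eqP; congr (_ * _).
  by rewrite -exprM -expnSr -cL expf_card expr1.
by apply: eq_bigr => j _; rewrite -exprM -expnSr.
Qed.
Lemma fixed_frob_exp (x : L) j : x ^+ q = x -> x ^+ (q ^ j) = x.
Proof. by move=> xq; elim: j => [|j IH]; rewrite ?expr1 // expnSr exprM IH. Qed.

(** A polynomial that computes the norm at [s + x * D] for [x] in the subfield. Its leading
    coefficient is the norm of [D], hence nonzero when [D] is. *)
Definition norm_line (s D : L) : {poly L} :=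
  \prod_(j < d) ((D ^+ (q ^ j)) *: 'X + (s ^+ (q ^ j))%:P).

Lemma horner_norm_line (s D x : L) : x ^+ q = x ->
  (norm_line s D).[x] = frob_norm (s + x * D).
Proof.
move=> xq; rewrite horner_prod; apply: eq_bigr => j _.
by rewrite !hornerE frobD // exprMn (fixed_frob_exp _ xq) addrC mulrC.
Qed.

Lemma size_norm_line (s D : L) : D != 0 -> size (norm_line s D) = d.+1.
Proof.
move=> D0.
have sizeF (j : 'I_d) : size ((D ^+ (q ^ j)) *: 'X + (s ^+ (q ^ j))%:P) = 2.
  rewrite size_polyDl size_scale ?expf_neq0 // size_polyX //.
  by rewrite size_polyC; case: (_ == _).
rewrite size_prod => [|j _]; last by rewrite -size_poly_eq0 sizeF.
rewrite (eq_bigr (fun=> 2%N)) // sum_nat_const card_ord; lia.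
Qed.

(* The form [frob_norm] is anisotropic, so that it has degree [d] > 1 on every
   line. *)
Lemma card_line_norm (s D C : L) (r : seq L) : D != 0 -> uniq r ->
  {in r, forall x, x ^+ q = x /\ frob_norm (s + x * D) = frob_norm s + x * C} ->
  (size r <= d)%N.
Proof.
move=> D0 ur rP.
pose F := norm_line s D - (C *: 'X + (frob_norm s)%:P).
have sizeF : size F = d.+1.
  rewrite size_polyDl size_norm_line // size_polyN ltnS.
  apply: leq_trans (size_polyD _ _) _; rewrite geq_max.
  rewrite (leq_trans (size_scale_leq _ _)) ?size_polyX //.
  by rewrite (leq_trans (size_polyC_leq1 _)) // ltnW.
rewrite -ltnS -sizeF; apply: max_poly_roots => //.
  by rewrite -size_poly_eq0 sizeF.
apply/allP => x /rP[xq eqN].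
by rewrite rootE !hornerE horner_norm_line // eqN; apply/eqP; ring.
Qed.

Let K := {x : L | x ^+ q == x}.

(* [(s, (z, w))] is the line with slope [(frob_norm s, s)] and intercept
   [(z, w)] of the affine space [K * (K * L)]. *)
Definition incident (u : L * (K * L)) (v : K * (K * L)) : bool :=
  (val v.2.1 == val u.2.1 + val v.1 * frob_norm u.1) &&
  (v.2.2 == u.2.2 + val v.1 * u.1).

Lemma incident_point u v v' :
  incident u v -> incident u v' -> v.1 = v'.1 -> v = v'.
Proof.
case: v v' => [t [z w]] [t' [z' w']] /=.
move=> /andP[/= /eqP e1 /eqP e2] /andP[/= /eqP e3 /eqP e4] tt'.
rewrite -tt' in e3 e4 *.
congr (_, (_, _)); last by rewrite e2 e4.
by apply: val_inj; apply: etrans e1 (esym e3).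
Qed.

Lemma incident_slope u u' v :
  incident u v -> incident u' v -> u.1 = u'.1 -> u = u'.
Proof.
case: u u' v => [s [z w]] [s' [z' w']] [t [z2 w2]] /=.
move=> /andP[/= /eqP e1 /eqP e2] /andP[/= /eqP e3 /eqP e4] ss'.
rewrite -ss' in e3 e4 *.
congr (_, (_, _)).
  apply: val_inj; apply: (addIr (val t * frob_norm s)).
  exact: etrans (esym e1) e3.
by apply: (addIr (val t * s)); apply: etrans (esym e2) e4.
Qed.

Lemma incident_c4_free : c4_free incident.
Proof.
move=> u u' v v' uv u'v uv' u'v'.
have [eqt|net] := eqVneq v.1 v'.1.
  by right; apply: incident_point uv uv' eqt.
(* Two points with different first coordinates determine the slope of a line through both. *)
left; apply: (incident_slope uv u'v).
have nt : val v.1 - val v'.1 != 0 by rewrite subr_eq0 (inj_eq val_inj).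
apply: (mulfI nt).
move: uv u'v => /andP[_ /eqP e1] /andP[_ /eqP e2].
move: uv' u'v' => /andP[_ /eqP e3] /andP[_ /eqP e4].
by transitivity (v.2.2 - v'.2.2); [rewrite e1 e3 | rewrite e2 e4]; ring.
Qed.

Lemma incident_theta3_free : theta3_free incident d.
Proof.
move=> u v x y [inj_x inj_y xv yu uxyv].
(* [(C, D)] is the displacement to [v] from the point of [u] with the same first coordinate. The
   slope of [y i] differs from that of [u] by [lam i] times this vector. *)
pose D := v.2.2 - u.2.2 - val v.1 * u.1.
pose C := val v.2.1 - val u.2.1 - val v.1 * frob_norm u.1.
pose lam i := (val v.1 - val (x i).1)^-1.
have net i : val v.1 - val (x i).1 != 0.
  rewrite subr_eq0 (inj_eq val_inj); apply/eqP => eqt.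
  have [_ yx yv] := uxyv i; exact: (xv i) (incident_point yx yv (esym eqt)).
have slope i : (y i).1 = u.1 + lam i * D.
  apply: (mulfI (net i)); rewrite mulrDr mulVKf //.
  have [/andP[_ /eqP e1] /andP[_ /eqP e2] /andP[_ /eqP e3]] := uxyv i.
  transitivity (v.2.2 - (x i).2.2); first by rewrite e3 e2; ring.
  by rewrite /D e1; ring.
have norm i : frob_norm (u.1 + lam i * D) = frob_norm u.1 + lam i * C.
  rewrite -slope; apply: (mulfI (net i)); rewrite mulrDr mulVKf //.
  have [/andP[/eqP e1 _] /andP[/eqP e2 _] /andP[/eqP e3 _]] := uxyv i.
  transitivity (val v.2.1 - val (x i).2.1); first by rewrite e3 e2; ring.
  by rewrite /C e1; ring.
(* If [D] vanished, [y i] would have the direction of [u] and meet it in [x i], hence equal [u]. *)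
have D0 : D != 0.
  apply/eqP => D0; pose i0 := Ordinal (ltnW d_gt1).
  have [ux yx _] := uxyv i0; apply: (yu i0); apply: (incident_slope yx ux).
  by rewrite slope D0 mulr0 addr0.
have lam_fix i : lam i ^+ q = lam i.
  rewrite exprVn; congr (_^-1).
  have := frobB 1 (val v.1) (val (x i).1) (fun=> erefl).
  by rewrite expn1 => ->; rewrite (eqP (valP v.1)) (eqP (valP (x i).1)).
have lam_inj : injective lam.
  move=> i j /invr_inj/addrI/oppr_inj/val_inj eqt; apply: inj_x.
  have [[ux _ _] [ux' _ _]] := (uxyv i, uxyv j); exact: (incident_point ux ux').
(* The parameter 0 stands for the direction of [u] itself; with the [d] distinct nonzero [lam i]
   this makes one parameter too many. *)
have := @card_line_norm u.1 D C (0 :: [seq lam i | i : 'I_d]) D0.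
rewrite /= size_map size_enum_ord ltnn => /(_ _ _)/negP; apply => //.
  rewrite map_inj_uniq ?enum_uniq // andbT; apply/mapP => -[i _ /eqP].
  by rewrite eq_sym invr_eq0 (negPf (net i)).
move=> z; rewrite inE => /orP[/eqP ->|/mapP[i _ ->]] //.
by rewrite !mul0r !addr0 expr0n eqn0Ngt ltnW.
Qed.

Lemma card_incident : (q ^ (2 * d + 2) <= #|[set p | incident p.1 p.2]|)%N.
Proof.
(* A line has exactly one point for each first coordinate [t]. The default of [insubd] never occurs,
   because norms lie in [K]. *)
pose point (u : L * (K * L)) (t : K) : K * (K * L) :=
  (t, (insubd t (val u.2.1 + val t * frob_norm u.1), u.2.2 + val t * u.1)).
pose f (p : (L * (K * L)) * K) := (p.1, point p.1 p.2).
have inj_f : injective f by move=> [u t] [u' t'] [-> ->].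
rewrite -(_ : #|{: (L * (K * L)) * K}| = q ^ (2 * d + 2))%N; last first.
  rewrite !card_prod !card_fixed_frob cardL -expnS -expnD -expnSr.
  by congr (_ ^ _)%N; lia.
rewrite -(card_imset _ inj_f); apply: subset_leq_card.
apply/fintype.subsetP => _ /imsetP[[u t] _ ->].
rewrite inE /incident /= eqxx andbT.
rewrite insubdK // unfold_in.
have := frobD 1 (val u.2.1) (val t * frob_norm u.1) (fun=> erefl).
rewrite expn1 exprMn => ->.
by rewrite (eqP (valP u.2.1)) (eqP (valP t)) (eqP (frob_norm_fixed _)).
Qed.
End NormConstruction.

Local Close Scope ring_scope.

(** * Transfer of both bounds to [ex_bip] *)

Lemma c4_theta3_freeP (a b l : nat) (E : {set 'I_a * 'I_b}) : 0 < l ->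
  all (fun H => ~~ contains (bipartite_graph E) H)
      [:: cycle_graph 4; theta_graph 3 l]
  <-> c4_free (edge_rel E) /\ theta3_free (edge_rel E) l.
Proof.
move=> l0; rewrite /= andbT; split.
  by move=> /andP[/contains_cycle4 ? /(contains_theta3 _ l0) ?].
by move=> [/contains_cycle4 -> /(contains_theta3 _ l0) ->].
Qed.

Lemma ex_bip_c4_theta3_le (a b l : nat) :
  let e := ex_bip a b [:: cycle_graph 4; theta_graph 3 l.+1] in
  [\/ e <= 8 * a, e <= 8 * b | e ^ 3 <= 128 * l * (a * b) ^ 2].
Proof.
(* The disjunction holds for 0 and is inherited by maxima, so it suffices to check each admissible
   edge set. *)
rewrite /ex_bip; elim/big_ind: _ =>
  [|m n Hm Hn|E /(c4_theta3_freeP E (ltn0Sn l))[c4f thf]].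
- by constructor 1.
- by rewrite /maxn; case: ifP.
- have := c4_theta3_free_edges c4f thf; rewrite !card_ord.
  by rewrite (_ : [set p | _] = E) //; apply/setP => -[u v]; rewrite inE.
Qed.

(** Padding the parts adds isolated vertices only. Every vertex of a forbidden copy lies on an edge,
    so the copy pulls back to [A] and [B]. *)
Lemma ex_bip_c4_theta3_ge (A B : finType) (E : A -> B -> bool) (a b l : nat) :
  0 < l -> #|A| <= a -> #|B| <= b -> c4_free E -> theta3_free E l ->
  #|[set p | E p.1 p.2]| <= ex_bip a b [:: cycle_graph 4; theta_graph 3 l].
Proof.
move=> l0 leA leB c4f thf.
pose f u := widen_ord leA (enum_rank u).
pose g v := widen_ord leB (enum_rank v).
have inj_f : injective f by move=> u u' /(congr1 val)/= /ord_inj/enum_rank_inj.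
have inj_g : injective g by move=> v v' /(congr1 val)/= /ord_inj/enum_rank_inj.
pose fg (p : A * B) := (f p.1, g p.2).
have inj_fg : injective fg.
  by move=> [u v] [u' v'] /pair_equal_spec[/inj_f/= -> /inj_g/= ->].
pose E' := fg @: [set p | E p.1 p.2].
have E'P u' v' : edge_rel E' u' v' ->
    exists u v, [/\ u' = f u, v' = g v & E u v].
  by move=> /imsetP[[u v]]; rewrite inE /= => Euv [-> ->]; exists u, v.
have E'fg u v : edge_rel E' (f u) (g v) -> E u v.
  by move=> /E'P[u' [v' [/inj_f -> /inj_g ->]]].
rewrite -(card_imset _ inj_fg).
apply: (@leq_bigmax_cond _ _ (fun E => #|pred_of_set E|) E').
apply/(c4_theta3_freeP _ l0); split.
  move=> u1 u2 v1 v2 e1 e2 e3.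
  have [u [v [eu ev _]]] := E'P _ _ e1; have [u' [_ [eu' _ _]]] := E'P _ _ e2.
  have [_ [v' [_ ev' _]]] := E'P _ _ e3.
  rewrite {}eu {}ev {}eu' {}ev' in e1 e2 e3 * => e4.
  by case: (c4f u u' v v'); rewrite ?E'fg // => ->; [left|right].
move=> u v x y [inj_x inj_y xv yu uxyv].
have [/E'P[u0 [_ [eu _ _]]] _ /E'P[_ [v0 [_ ev _]]]] := uxyv (Ordinal l0).
have [x0 xE] : exists x0 : 'I_l -> B, forall i, x i = g (x0 i).
  apply: (@fin_all_exists _ (fun=> B) (fun i w => x i = g w)) => i.
  by have [/E'P[_ [w [_ -> _]]] _ _] := uxyv i; exists w.
have [y0 yE] : exists y0 : 'I_l -> A, forall i, y i = f (y0 i).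
  apply: (@fin_all_exists _ (fun=> A) (fun i w => y i = f w)) => i.
  by have [_ /E'P[w [_ [-> _ _]]] _] := uxyv i; exists w.
case: (thf u0 v0 x0 y0); split.
- by move=> i j eqx; apply: inj_x; rewrite !xE eqx.
- by move=> i j eqy; apply: inj_y; rewrite !yE eqy.
- by move=> i eqx; apply: (xv i); rewrite xE ev eqx.
- by move=> i eqy; apply: (yu i); rewrite yE eu eqy.
- move=> i; have := uxyv i; rewrite eu ev xE yE.
  by move=> [/E'fg ? /E'fg ? /E'fg ?].
Qed.

(** For [d = 4] the part sizes are [q^9] and [q^6], with [q^10 = (q^9)^(10/9)] edges. *)
Lemma ex_bip_c4_theta3_prime_power (p k d a b : nat) :
  prime p -> 0 < k -> 1 < d -> let q := p ^ k in
  q ^ (2 * d + 1) <= a -> q ^ (d + 2) <= b ->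
  q ^ (2 * d + 2) <= ex_bip a b [:: cycle_graph 4; theta_graph 3 d].
Proof.
move=> pr_p k0 d1 q qa qb.
have kd0 : 0 < k * d by rewrite muln_gt0 k0 ltnW.
have [L pcharL cardL] := pPrimePowerField pr_p kd0.
have q1 : 1 < q by rewrite -(exp1n k) ltn_exp2r ?prime_gt1.
have pnat_q : ([pchar L]%R).-nat q.
  by rewrite (eq_pnat _ (pcharf_eq pcharL)) pnatX pnat_id.
rewrite expnM -/q in cardL.
apply: leq_trans (card_incident q1 pnat_q cardL d1) _.
apply: ex_bip_c4_theta3_ge.
- exact: ltnW.
- rewrite !card_prod (card_fixed_frob q1 pnat_q cardL) cardL -expnS -expnD.
  by rewrite addnS addnn -mul2n -addn1.
- by rewrite !card_prod (card_fixed_frob q1 pnat_q cardL) cardL -!expnS -addn2.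
- exact: incident_c4_free.
- exact: incident_theta3_free.
Qed.

(** * Asymptotics for general [n] *)

Local Open Scope ring_scope.

Theorem corollary1p3 (R : realType) :
  exists (c1 c2 : R) (n0 : nat),
    [/\ 0 < c1, 0 < c2 &
      forall n : nat, (n0 <= n)%N ->
        let e := ex_bip n (Num.truncn (n%:R `^ (2 / 3) : R))
                        [:: cycle_graph 4; theta_graph 3 4] in
        c1 * n%:R `^ (1 + 1 / 9) <= e%:R /\
        e%:R <= c2 * n%:R `^ (1 + 1 / 9)].
Proof.
(* The loss of a factor 2 in [q] costs 1024 = 2^10 in [q^10]; 8 works above since 8^3 = 512 is at
   least 128 * 3; and 512 = 2^9 is the first ninth power of a power of 2 beyond 1. *)
exists (1024%:R^-1), 8, 512; split; rewrite ?invr_gt0 ?ltr0n // => n n_ge.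
pose y : R := n%:R `^ (1 / 9).
have powE (k : nat) : n%:R `^ (k%:R / 9) = y ^+ k :> R.
  by rewrite -powR_mulrn ?powR_ge0 // -powRrM; congr (_ `^ _); field.
have -> : n%:R `^ (2 / 3) = y ^+ 6 :> R by rewrite -powE; congr (_ `^ _); field.
have -> : n%:R `^ (1 + 1 / 9) = y ^+ 10 :> R.
  by rewrite -powE; congr (_ `^ _); field.
have y9 : y ^+ 9 = n%:R by rewrite -powE divff ?pnatr_eq0 // powRr1.
have y_ge0 : 0 <= y := powR_ge0 _ _.
have y_ge1 : 1 <= y.
  rewrite -(ler_pXn2r (n := 9)) ?nnegrE // y9 expr1n ler1n.
  exact: leq_trans n_ge.
set m := Num.truncn _.
have m_le : m%:R <= y ^+ 6 by rewrite truncn_le exprn_ge0.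
split; last first.
  have [le_e|le_e|le_e] := ex_bip_c4_theta3_le n m 3.
  - apply: (@le_trans _ _ (8 * n%:R)); first by rewrite -natrM ler_nat.
    by rewrite ler_pM2l // -y9 ler_weXn2l.
  - apply: (@le_trans _ _ (8 * m%:R)); first by rewrite -natrM ler_nat.
    by rewrite ler_pM2l // (le_trans m_le) // ler_weXn2l.
  - rewrite -(ler_pXn2r (n := 3)) ?nnegrE ?mulr_ge0 ?exprn_ge0 // -natrX.
    apply: (@le_trans _ _ (384 * (n%:R * m%:R) ^+ 2)).
      by rewrite -natrM -natrX -natrM ler_nat.
    apply: (@le_trans _ _ (384 * (y ^+ 9 * y ^+ 6) ^+ 2)).
      rewrite ler_pM2l // -y9 lerXn2r ?nnegrE ?mulr_ge0 ?exprn_ge0 //.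
      by rewrite ler_wpM2l ?exprn_ge0.
    have : 0 <= y ^+ 30 by rewrite exprn_ge0.
    have -> : 384 * (y ^+ 9 * y ^+ 6) ^+ 2 = 384 * y ^+ 30 by ring.
    have -> : (8 * y ^+ 10) ^+ 3 = 512 * y ^+ 30 by ring.
    lra.
(* Base 512 = 2^9 makes [q = 2^k] the largest power of 2 with [q^9] at most [n], so that
   [q <= y < 2 * q]. *)
pose k := trunc_log 512 n.
have /andP[le_n lt_n] : (512 ^ k <= n < 512 ^ k.+1)%N.
  by apply: trunc_log_bounds => //; apply: leq_trans n_ge.
have k0 : (0 < k)%N by rewrite trunc_log_gt0.
have pow2 j : (512 ^ j = (2 ^ j) ^ 9)%N by rewrite -expnM mulnC expnM.
have q_le : (2 ^ k)%:R <= y.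
  by rewrite -(ler_pXn2r (n := 9)) ?nnegrE // y9 -natrX ler_nat -pow2.
have lt_q : y < 2 * (2 ^ k)%:R.
  rewrite -(ltr_pXn2r (n := 9)) ?nnegrE // y9.
  by rewrite -natrM -expnS -natrX ltr_nat -pow2.
have le_m : ((2 ^ k) ^ 6 <= m)%N.
  by rewrite truncn_ge_nat ?exprn_ge0 // natrX lerXn2r ?nnegrE.
rewrite pow2 in le_n.
have le_ex := @ex_bip_c4_theta3_prime_power 2 k 4 n m isT k0 isT le_n le_m.
rewrite mulrC ler_pdivrMr ?ltr0n //.
apply: (@le_trans _ _ ((2 ^ k)%:R ^+ 10 * 1024)).
  rewrite (_ : _ * 1024 = (2 * (2 ^ k)%:R) ^+ 10); last by ring.
  by rewrite lerXn2r ?nnegrE // ltW.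
by rewrite ler_pM2r // -natrX ler_nat.
Qed.
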